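(* Let $D\subsetneq\mathbb{R}^n$ be a domain and $x,y\in D$. Then $$\tilde\tau_D(x,y)\ge(\log 3)\,s_D(x,y).$$ The inequality is sharp, i.e. the constant $\log3$ cannot be replaced by a larger constant so that the inequality remains valid for all domains $D\subsetneq\mathbb{R}^n$ and all $x,y\in D$.
   Context: Here $n\ge2$, a domain is an open connected nonempty set, and the boundary $\partial D$ is taken in $\mathbb{R}^n$. For $x,y\in D$, $$\tilde\tau_D(x,y)=\log\left(1+\sup_{p\in\partial D}\frac{|x-y|}{\sqrt{|x-p||p-y|}}\right),\qquad s_D(x,y)=\sup_{p\in\partial D}\frac{|x-y|}{|x-p|+|p-y|}$$ ($s_D$ is the triangular ratio metric). *)

(* Defs.v *)
From HB Require Import structures.
From mathcomp Require Import all_boot all_order all_algebra.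
From mathcomp Require Import all_classical all_reals all_analysis.
Set Implicit Arguments.
Unset Strict Implicit.
Unset Printing Implicit Defensive.
Import Order.TTheory GRing.Theory Num.Theory.
Import numFieldNormedType.Exports.
Local Open Scope classical_set_scope.
Local Open Scope ring_scope.

(* The library norm `|x| on 'rV[R]_n is the max norm; it induces the usual
   topology of R^n, so it is only the metric that has to be defined here. *)
Definition enorm (R : realType) (n : nat) (x : 'rV[R]_n) : R :=
  Num.sqrt (\sum_(i < n) x ord0 i ^+ 2).

Definition domain (R : realType) (n : nat) (D : set 'rV[R]_n) : Prop :=
  [/\ open D, connected D & D !=set0].

Definition boundary (T : topologicalType) (D : set T) : set T :=
  closure D `\` interior D.

(* The two suprema below are real-valued. For a domain D != R^n and x, y in D
   they are suprema of nonempty bounded sets with nonzero denominators: the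
   boundary is nonempty because R^n is connected, and it stays at a positive
   distance from x and y because D is open. *)
Definition tau_tilde (R : realType) (n : nat) (D : set 'rV[R]_n)
    (x y : 'rV[R]_n) : R :=
  ln (1 + sup [set enorm (x - y) / Num.sqrt (enorm (x - p) * enorm (p - y))
                | p in boundary D]).

(* the triangular ratio metric *)
Definition triangular_ratio (R : realType) (n : nat) (D : set 'rV[R]_n)
    (x y : 'rV[R]_n) : R :=
  sup [set enorm (x - y) / (enorm (x - p) + enorm (p - y)) | p in boundary D].

(* Main.v *)
Require Import Defs.
From HB Require Import structures.
From mathcomp Require Import all_boot all_order all_algebra.
From mathcomp Require Import all_classical all_reals all_analysis.
From mathcomp Require Import ring lra.
Import Order.TTheory GRing.Theory Num.Theory.
Import numFieldNormedType.Exports.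
Local Open Scope classical_set_scope.
Local Open Scope ring_scope.

(** For each boundary point [p] the triangle inequality gives
    [s_p := |x-y|/(|x-p|+|p-y|) <= 1] and AM-GM gives
    [|x-y|/sqrt(|x-p||p-y|) >= 2 s_p], so the inequality reduces to
    [ln (1 + 2s) >= s ln 3] on [0, 1], which is concavity of [ln] between
    [1] and [3].  Equality holds when the midpoint of [x] and [y] lies on the
    boundary and every other boundary point [p] satisfies [|x-p||p-y| >= 1]
    (with [|x-y| = 2]); this happens for [x = e_i], [y = -e_i] in the
    complement of the closed half-hyperplane [p_i = 0, p_j <= 0], a domain
    which is star-shaped with respect to [e_j]. *)

(** * The Euclidean norm: Cauchy-Schwarz and the triangle inequality *)

Lemma enorm_ge0 (R : realType) (n : nat) (x : 'rV[R]_n) : 0 <= enorm x.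
Proof. exact: sqrtr_ge0. Qed.

Lemma sqr_enorm (R : realType) (n : nat) (x : 'rV[R]_n) :
  enorm x ^+ 2 = \sum_(i < n) x ord0 i ^+ 2.
Proof. by rewrite sqr_sqrtr// sumr_ge0// => i _; exact: sqr_ge0. Qed.

(** Compares the max norm, which carries the topology, with the Euclidean norm; it also bounds
    distances to a hyperplane [p_i = 0] from below. *)
Lemma ler_coord_enorm (R : realType) (n : nat) (x : 'rV[R]_n) (i : 'I_n) :
  `|x ord0 i| <= enorm x.
Proof.
rewrite -sqrtr_sqr; apply: ler_wsqrtr.
by rewrite (bigD1 i)//= lerDl sumr_ge0// => k _; exact: sqr_ge0.
Qed.

Lemma enorm_eq0 (R : realType) (n : nat) (x : 'rV[R]_n) : enorm x = 0 -> x = 0.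
Proof.
move=> x0; apply/matrixP => k i; rewrite ord1 mxE.
by apply/eqP; rewrite -normr_le0 -x0 ler_coord_enorm.
Qed.

Lemma enormN (R : realType) (n : nat) (x : 'rV[R]_n) : enorm (- x) = enorm x.
Proof.
by congr Num.sqrt; apply: eq_bigr => i _; rewrite mxE sqrrN.
Qed.

(** Cauchy-Schwarz: with [a], [b] the two norms, both nonzero, the difference of the sides times
    [2ab] is the sum of the squares [(b x_i - a y_i)^2]. *)
Lemma dot_le_enorm (R : realType) (n : nat) (x y : 'rV[R]_n) :
  \sum_(i < n) x ord0 i * y ord0 i <= enorm x * enorm y.
Proof.
have [/enorm_eq0 ->|x0] := eqVneq (enorm x) 0.
  rewrite big1 ?mulr_ge0 ?enorm_ge0// => i _; by rewrite mxE mul0r.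
have [/enorm_eq0 ->|y0] := eqVneq (enorm y) 0.
  rewrite big1 ?mulr_ge0 ?enorm_ge0// => i _; by rewrite mxE mulr0.
have xy_gt0 : 0 < enorm x * enorm y.
  by rewrite mulr_gt0// lt_neqAle eq_sym ?x0 ?y0 enorm_ge0.
rewrite -subr_ge0 -(pmulr_rge0 _ xy_gt0) -(pmulr_rge0 _ (ltr0n _ 2)).
set a := enorm x in xy_gt0 *; set b := enorm y in xy_gt0 *.
have -> : 2 * (a * b * (a * b - \sum_(i < n) x ord0 i * y ord0 i)) =
    \sum_(i < n) (b * x ord0 i - a * y ord0 i) ^+ 2.
  transitivity (b ^+ 2 * (\sum_(i < n) x ord0 i ^+ 2)
      - 2 * (a * b) * (\sum_(i < n) x ord0 i * y ord0 i)
      + a ^+ 2 * (\sum_(i < n) y ord0 i ^+ 2)).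
    by rewrite -!sqr_enorm -/a -/b; ring.
  rewrite !mulr_sumr -sumrB -big_split/=.
  by apply: eq_bigr => i _; ring.
by apply: sumr_ge0 => i _; exact: sqr_ge0.
Qed.

Lemma ler_enormD (R : realType) (n : nat) (x y : 'rV[R]_n) :
  enorm (x + y) <= enorm x + enorm y.
Proof.
rewrite -(@ler_pXn2r _ 2) ?nnegrE ?addr_ge0 ?enorm_ge0//.
rewrite sqrrD !sqr_enorm.
have -> : \sum_(i < n) (x + y) ord0 i ^+ 2 = \sum_(i < n) x ord0 i ^+ 2 +
   (\sum_(i < n) x ord0 i * y ord0 i) *+ 2 + \sum_(i < n) y ord0 i ^+ 2.
  rewrite -sumrMnl -!big_split/=; apply: eq_bigr => i _.
  by rewrite mxE sqrrD.
by rewrite lerD2r lerD2l lerMn2r dot_le_enorm orbT.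
Qed.

(** * Inequalities for a single point [p], and the chord of the logarithm *)

Lemma ler_enormB (R : realType) (n : nat) (x y p : 'rV[R]_n) :
  enorm (x - y) <= enorm (x - p) + enorm (p - y).
Proof.
have -> : x - y = (x - p) + (p - y) by rewrite addrA subrK.
exact: ler_enormD.
Qed.

(* At [x = p = y] the quotient is [0 / 0 = 0]. *)
Lemma triangular_quotient_le1 (R : realType) (n : nat) (x y p : 'rV[R]_n) :
  enorm (x - y) / (enorm (x - p) + enorm (p - y)) <= 1.
Proof.
have := addr_ge0 (enorm_ge0 R n (x - p)) (enorm_ge0 R n (p - y)).
rewrite le_eqVlt => /predU1P[<-|s_gt0]; first by rewrite invr0 mulr0.
by rewrite ler_pdivrMr// mul1r ler_enormB.
Qed.

Lemma AGM2_sqrt (R : realType) (a b : R) : 0 <= a -> 0 <= b ->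
  2 * Num.sqrt (a * b) <= a + b.
Proof.
move=> a0 b0; rewrite sqrtrM//.
rewrite -{2}(sqr_sqrtr a0) -{2}(sqr_sqrtr b0) -subr_ge0.
have -> : forall s t : R, s ^+ 2 + t ^+ 2 - 2 * (s * t) = (s - t) ^+ 2.
  by move=> s t; ring.
exact: sqr_ge0.
Qed.

Lemma ln_chord13 (R : realType) (s : R) : 0 <= s <= 1 ->
  s * ln 3 <= ln (1 + 2 * s).
Proof.
move=> s01; have /andP[s0 s1] := s01.
pose t := Itv01 s0 s1.
(* The weights are [s] on 3 and [1 - s] on 1, so the convex combination is [1 + 2s], and [ln 1 = 0]
   removes the second term. *)
have := @concave_ln R t 3 1 (ltr0n _ 3) ltr01.
rewrite !convRE/= ln1 mulr0 addr0 => /le_trans; apply.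
rewrite (_ : _ + _ = 1 + 2 * s)//= mulr1 /unstable.onem; ring.
Qed.

(** * Boundary of an open set and the distance to its complement *)

Lemma boundary_open (T : topologicalType) (D : set T) :
  open D -> boundary D = closure D `\` D.
Proof. by move=> /interior_id oD; rewrite /boundary oD. Qed.

(** A max-norm ball of radius [r] about [x] lies in [D], and it contains the Euclidean ball of the
    same radius. This keeps the denominators away from 0. *)
Lemma open_enorm_gap (R : realType) (n : nat) (D : set 'rV[R]_n) (x : 'rV[R]_n) :
  open D -> D x -> exists2 r, 0 < r & forall p, ~ D p -> r <= enorm (x - p).
Proof.
rewrite openE => oD /oD /nbhs_ballP[r /= r0 rD]; exists r => // p Dp.
rewrite leNgt; apply/negP => xp; apply/Dp/rD; split=> // k i.
by rewrite ord1 /ball/= (le_lt_trans _ xp)// -[leRHS]/(enorm _)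
  (le_trans _ (ler_coord_enorm _ _ _ i))// !mxE.
Qed.

(** * The inequality for suprema over the boundary *)

Section sup_inequality.
Variables (R : realType) (n : nat) (D : set 'rV[R]_n) (x y : 'rV[R]_n).
Hypotheses (oD : open D) (Dx : D x) (Dy : D y).

(** Without an upper bound [sup] would carry no information about the quotients; the gaps [r] at [x]
    and [q] at [y] provide one. *)
Lemma tau_quotients_bounded :
  has_ubound [set enorm (x - y) / Num.sqrt (enorm (x - p) * enorm (p - y))
                | p in boundary D].
Proof.
have [r r0 xr] := open_enorm_gap _ _ _ _ oD Dx.
have [q q0 yq] := open_enorm_gap _ _ _ _ oD Dy.
exists (enorm (x - y) / Num.sqrt (r * q)) => _ [p + <-].
rewrite boundary_open// => -[_ Dp]; rewrite ler_wpM2l ?enorm_ge0//.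
have rq : r * q <= enorm (x - p) * enorm (p - y).
  by rewrite ler_pM ?(ltW r0) ?(ltW q0) ?xr// -enormN opprB yq.
have rq0 := mulr_gt0 r0 q0.
by rewrite lef_pV2 ?posrE ?sqrtr_gt0 ?(lt_le_trans rq0 rq)// ler_wsqrtr.
Qed.

Lemma tau_quotient_ge (p : 'rV[R]_n) : ~ D p ->
  2 * (enorm (x - y) / (enorm (x - p) + enorm (p - y))) <=
  enorm (x - y) / Num.sqrt (enorm (x - p) * enorm (p - y)).
Proof.
move=> Dp.
have [r r0 /(_ p Dp) xr] := open_enorm_gap _ _ _ _ oD Dx.
have [q q0 /(_ p Dp) yq] := open_enorm_gap _ _ _ _ oD Dy.
have a0 := lt_le_trans r0 xr.
have b0 : 0 < enorm (p - y) by rewrite -enormN opprB (lt_le_trans q0).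
rewrite mulrCA ler_wpM2l ?enorm_ge0//.
rewrite ler_pdivrMr ?addr_gt0// mulrC ler_pdivlMr ?sqrtr_gt0 ?mulr_gt0//.
by rewrite AGM2_sqrt// ltW.
Qed.

Lemma tau_tilde_ge_triangular_ratio :
  tau_tilde D x y >= ln 3 * triangular_ratio D x y.
Proof.
rewrite /tau_tilde /triangular_ratio.
(* Over an empty boundary both suprema take the default value 0, and both sides vanish. *)
have [->|/set0P[p0 bp0]] := eqVneq (boundary D) set0.
  by rewrite !image_set0 !sup0 mulr0 addr0 ln1.
set S := sup _; set T := sup _.
(* The range in which the chord bound applies; the quotient at [p0] witnesses nonnegativity. *)
have S01 : 0 <= S <= 1.
  apply/andP; split; last first.
    apply: ge_sup; first by eexists; exists p0.
    by move=> _ [p _ <-]; exact: triangular_quotient_le1.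
  apply: (@le_trans _ _ (enorm (x - y) / (enorm (x - p0) + enorm (p0 - y)))).
    by rewrite divr_ge0 ?addr_ge0 ?enorm_ge0.
  apply: ub_le_sup; last by exists p0.
  by exists 1 => _ [p _ <-]; exact: triangular_quotient_le1.
have ST : 2 * S <= T.
  rewrite mulrC -ler_pdivlMr//; apply: ge_sup; first by eexists; exists p0.
  move=> _ [p bp <-]; rewrite ler_pdivlMr// mulrC.
  apply: (le_trans (tau_quotient_ge p _)).
    by move: bp; rewrite boundary_open// => -[].
  by apply: ub_le_sup; [exact: tau_quotients_bounded|exists p].
rewrite mulrC (le_trans (ln_chord13 _ _ S01))// ler_ln ?posrE ?lerD2l//.
  by rewrite ltr_wpDr// mulr_ge0//; case/andP: S01.
by rewrite ltr_wpDr// (le_trans _ ST)// mulr_ge0//; case/andP: S01.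
Qed.

End sup_inequality.

(** * Connectedness of star-shaped sets *)

Lemma star_shaped_connected (R : realType) (V : normedModType R) (A : set V) (c : V) :
  A c ->
  (forall x (t : R), A x -> 0 <= t <= 1 -> A (c + t *: (x - c))) ->
  connected A.
Proof.
move=> Ac star.
(* The segments from [c] to the points of [A] are connected as continuous images of [[0, 1]], and
   all contain [c]. *)
have -> : A = \bigcup_(x in A) [set c + t *: (x - c) | t in `[0, 1]].
  apply/seteqP; split=> [x Ax|z [x Ax [t /=]]].
    by exists x => //; exists 1; rewrite /= ?in_itv/= ?ler01 ?lexx// scale1r addrC subrK.
  by rewrite in_itv/= => t01 <-; exact: star.
apply: bigcup_connected.
  by exists c => x _; exists 0; rewrite /= ?in_itv/= ?ler01 ?lexx// scale0r addr0.
move=> x _; apply: connected_continuous_connected; first exact: segment_connected.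
apply: continuous_subspaceT => t.
by apply: cvgD; [exact: cvg_cst|exact: scalel_continuous].
Qed.

(** * The extremal domain *)

Section half_hyperplane_complement.
Variables (R : realType) (n : nat) (i j : 'I_n).
Hypothesis ij : i != j.

Let e (k : 'I_n) : 'rV[R]_n := delta_mx ord0 k.

(** The opening [p_j > 0] joins the two sides of the hyperplane [p_i = 0], while the boundary stays
    inside that hyperplane. *)
Definition half_hyperplane_compl : set 'rV[R]_n :=
  [set p | p ord0 i != 0 \/ 0 < p ord0 j].

Local Notation D := half_hyperplane_compl.

Lemma half_hyperplane_compl_open : open D.
Proof.
have -> : D = (fun p : 'rV[R]_n => p ord0 i) @^-1` ([set u | u < 0] `|` [set u | 0 < u])
              `|` (fun p : 'rV[R]_n => p ord0 j) @^-1` [set u | 0 < u].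
  by apply/seteqP; split=> p; rewrite /D/= neq_lt => -[/orP|]; auto.
apply: openU; apply: open_comp; do ?[by move=> p _; exact: coord_continuous].
- by apply: openU; [exact: open_lt|exact: open_gt].
- exact: open_gt.
Qed.

Lemma half_hyperplane_compl_domain : domain D.
Proof.
have Dej : D (e j) by right; rewrite !mxE !eqxx ltr01.
split; [exact: half_hyperplane_compl_open | | by exists (e j)].
apply: (star_shaped_connected _ _ _ (e j)) => // p t Dp /andP[t0 t1].
(* At [t = 0] the point is [e j]. Otherwise its coordinates are [t p_i] at [i], nonzero with [p_i],
   and [1 - t + t p_j] at [j], positive with [p_j]. *)
have [->|tn0] := eqVneq t 0; first by rewrite scale0r addr0.
case: Dp => [pi|pj]; [left|right]; rewrite !mxE !eqxx/=.
  by rewrite (negbTE ij)/= subr0 add0r mulf_neq0.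
have : 0 < t * p ord0 j by rewrite mulr_gt0// lt_neqAle eq_sym tn0.
nra.
Qed.

(** The origin is outside [D] but is the limit of small positive multiples of [e j], which lie in
    [D]. *)
Lemma half_hyperplane_compl_boundary0 : boundary D 0.
Proof.
rewrite boundary_open; last exact: half_hyperplane_compl_open.
split; last by rewrite /D/= !mxE eqxx ltxx => -[].
move=> B /nbhs_ballP[r /= r0 rB]; exists ((r / 2) *: e j); split.
  by right; rewrite !mxE !eqxx/= mulr1 divr_gt0.
apply: rB; split=> // k l; rewrite /ball/= !mxE sub0r normrN.
rewrite normrM (ger0_norm (ltW (divr_gt0 r0 _)))//.
by case: (_ && _); rewrite ?normr1 ?normr0; lra.
Qed.

Lemma half_hyperplane_compl_boundary (p : 'rV[R]_n) :
  boundary D p -> p ord0 i = 0.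
Proof.
rewrite boundary_open; last exact: half_hyperplane_compl_open.
by case=> _ Dp; apply/eqP; apply: contrapT => /negP pi; apply: Dp; left.
Qed.

Lemma enormZ_basis (a : R) : enorm (a *: e i) = `|a|.
Proof.
rewrite /enorm (bigD1 i)//= big1 ?addr0 => [|k ki].
  by rewrite !mxE !eqxx/= mulr1 sqrtr_sqr.
by rewrite !mxE (negbTE ki) andbF mulr0 expr0n.
Qed.

(** Boundary points have zero coordinate at [i], so both distances are at least 1 and each quotient
    is at most [2 / 1]. *)
Lemma half_hyperplane_compl_tau : tau_tilde D (e i) (- e i) <= ln 3.
Proof.
have dist2 : enorm (e i - - e i) = 2.
  by rewrite opprK -mulr2n -scaler_nat enormZ_basis normr_nat.
rewrite /tau_tilde; set E := (X in sup X).
have E2 : ubound E 2.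
  move=> _ [p /half_hyperplane_compl_boundary pi <-]; rewrite dist2.
  have a1 : 1 <= enorm (e i - p).
    by rewrite (le_trans _ (ler_coord_enorm _ _ _ i))// !mxE pi !eqxx subr0 normr1.
  have b1 : 1 <= enorm (p - - e i).
    by rewrite (le_trans _ (ler_coord_enorm _ _ _ i))// !mxE pi !eqxx opprK add0r normr1.
  have s1 : 1 <= Num.sqrt (enorm (e i - p) * enorm (p - - e i)).
    by rewrite -{1}sqrtr1 ler_wsqrtr// -(mul1r 1) ler_pM.
  by rewrite ler_pdivrMr ?(lt_le_trans _ s1)// ler_peMr.
(* A nonnegative member makes the set nonempty and the argument of the logarithm positive. *)
have [t Et t0] : exists2 t, E t & 0 <= t.
  eexists; first by exists 0; first exact: half_hyperplane_compl_boundary0.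
  by rewrite divr_ge0 ?enorm_ge0 ?sqrtr_ge0.
have T2 : sup E <= 2 by apply: ge_sup => //; exists t.
have T0 : 0 <= sup E by apply: (le_trans t0); apply: ub_le_sup => //; exists 2.
by rewrite ler_ln ?posrE ?ltr_wpDr//; lra.
Qed.

(** The boundary point 0 is the midpoint of the two points, so its quotient is [2 / (1 + 1)]. *)
Lemma half_hyperplane_compl_ratio : 1 <= triangular_ratio D (e i) (- e i).
Proof.
apply: ub_le_sup.
  by exists 1 => _ [p _ <-]; exact: triangular_quotient_le1.
exists 0; first exact: half_hyperplane_compl_boundary0.
rewrite opprK subr0 add0r -mulr2n -scaler_nat enormZ_basis normr_nat.
by rewrite -(scale1r (e i)) enormZ_basis normr1 divff.
Qed.

End half_hyperplane_complement.

(** * The inequality and its sharpness *)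

Theorem theorem5p8 (R : realType) (n : nat) (hn : (2 <= n)%N) :
  (forall (D : set 'rV[R]_n) (x y : 'rV[R]_n),
     domain D -> D <> setT -> D x -> D y ->
     tau_tilde D x y >= ln 3 * triangular_ratio D x y) /\
  (forall c : R, c > ln 3 ->
     ~ (forall (D : set 'rV[R]_n) (x y : 'rV[R]_n),
          domain D -> D <> setT -> D x -> D y ->
          tau_tilde D x y >= c * triangular_ratio D x y)).
Proof.
split=> [D x y [oD _ _] _ Dx Dy|c c3].
  exact: tau_tilde_ge_triangular_ratio.
(* The coordinates 0 and 1, which exist since [n] is at least 2. *)
pose i : 'I_n := Ordinal (ltnW hn); pose j : 'I_n := Ordinal hn.
have ij : i != j by [].
move=> /(_ (half_hyperplane_compl R n i j) (delta_mx ord0 i) (- delta_mx ord0 i)).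
move=> /(_ (half_hyperplane_compl_domain _ _ _ _ ij)) le_c.
have c0 : 0 < c by rewrite (lt_trans _ c3)// ln_gt0// ltr1n.
suff : c <= ln 3 by rewrite leNgt c3.
apply: (le_trans _ (half_hyperplane_compl_tau R n i j)).
(* As [c] is positive and the ratio is at least 1, [c] is at most [c] times the ratio, hence at most
   [tau_tilde]. *)
apply: (@le_trans _ _ (c * triangular_ratio (half_hyperplane_compl R n i j)
    (delta_mx ord0 i) (- delta_mx ord0 i))).
  by rewrite ler_peMr ?(ltW c0)// half_hyperplane_compl_ratio.
apply: le_c.
(* The origin shows that the domain is not the whole space. *)
- move/seteqP => [_ /(_ 0 I)]; rewrite /half_hyperplane_compl/= !mxE eqxx ltxx.
  by case.
- by left; rewrite !mxE !eqxx oner_eq0.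
- by left; rewrite !mxE !eqxx oppr_eq0 oner_eq0.
Qed.
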